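(* Every doubly distributive skew hyperfield $F$ is stringent; that is, for all $a,b\in F$ with $a\neq -b$, the set $a\boxplus b$ is a singleton.
   Context: A hyperoperation on a set $S$ is a map $\boxplus$ from $S\times S$ to the nonempty subsets of $S$; for nonempty $A,B\subseteq S$ put $A\boxplus B=\bigcup_{a\in A,b\in B}a\boxplus b$; $\boxplus$ is associative if $a\boxplus(b\boxplus c)=(a\boxplus b)\boxplus c$ for all $a,b,c$. A hypergroup is $(G,\boxplus,0)$ with $\boxplus$ an associative hyperoperation such that: $0\boxplus x=x\boxplus 0=\{x\}$ for all $x$; for every $x$ there is a unique $x'$ with $0\in x\boxplus x'$ and a unique $x''$ with $0\in x''\boxplus x$, and $x'=x''$, denoted $-x$; and $x\in y\boxplus z$ if and only if $-x\in -z\boxplus -y$. It is commutative if $y\boxplus z=z\boxplus y$ for all $y,z$. A skew hyperring is $(R,\odot,\boxplus,1,0)$ with $(R,\odot,1)$ a monoid, $(R,\boxplus,0)$ a commutative hypergroup, $x\odot 0=0\odot x=0$, and $a\odot(x\boxplus y)=(a\odot x)\boxplus(a\odot y)$, $(x\boxplus y)\odot a=(x\odot a)\boxplus(y\odot a)$. A skew hyperfield is a skew hyperring with $0\ne1$ in which every nonzero element has a multiplicative inverse. It is doubly distributive if $(a\boxplus b)(c\boxplus d)=ac\boxplus ad\boxplus bc\boxplus bd$ for all $a,b,c,d$ (products of sets being taken elementwise). *)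

(* Defs.v *)
From mathcomp Require Import all_boot.
From mathcomp Require Import boolp classical_sets.

Set Implicit Arguments.
Unset Strict Implicit.
Unset Printing Implicit Defensive.

Local Open Scope classical_set_scope.

Record hyperoperation (S : Type) := Hyperoperation {
  hyperop :> S -> S -> set S;
  hyperop_neq0 : forall x y, hyperop x y !=set0
}.

Definition hypersum (S : Type) (op : S -> S -> set S) (A B : set S) : set S :=
  \bigcup_(a in A) \bigcup_(b in B) op a b.

Definition hyperassociative (S : Type) (op : S -> S -> set S) : Prop :=
  forall a b c, hypersum op [set a] (op b c) = hypersum op (op a b) [set c].

(* The two [unique] clauses say at once that the right and the left inverse of
   [x] exist, are unique and coincide; hence [opp] is determined by [add]. *)
Record is_hypergroup (G : Type) (add : hyperoperation G)
    (zero : G) (opp : G -> G) : Prop := IsHypergroup {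
  hg_addA : hyperassociative add;
  hg_add0x : forall x, add zero x = [set x];
  hg_addx0 : forall x, add x zero = [set x];
  hg_oppr : forall x, unique (fun x' => add x x' zero) (opp x);
  hg_oppl : forall x, unique (fun x'' => add x'' x zero) (opp x);
  hg_rev : forall x y z, add y z x <-> add (opp z) (opp y) (opp x)
}.

Record skewHyperring := SkewHyperring {
  hr_sort :> Type;
  hadd : hyperoperation hr_sort;
  hmul : hr_sort -> hr_sort -> hr_sort;
  hone : hr_sort;
  hzero : hr_sort;
  hopp : hr_sort -> hr_sort;
  hmulA : associative hmul;
  hmul1x : left_id hone hmul;
  hmulx1 : right_id hone hmul;
  hadd_hypergroup : is_hypergroup hadd hzero hopp;
  haddC : forall x y, hadd x y = hadd y x;
  hmulx0 : right_zero hzero hmul;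
  hmul0x : left_zero hzero hmul;
  hmulDr : forall a x y,
    [set hmul a z | z in hadd x y] = hadd (hmul a x) (hmul a y);
  hmulDl : forall a x y,
    [set hmul z a | z in hadd x y] = hadd (hmul x a) (hmul y a)
}.

Arguments hadd {s}.
Arguments hmul {s}.
Arguments hopp {s}.
Arguments hone {s}.
Arguments hzero {s}.

Record skewHyperfield := SkewHyperfield {
  hf_ring :> skewHyperring;
  hone_neq0 : (hzero : hf_ring) <> hone;
  hf_inv : forall x : hf_ring, x <> hzero ->
    exists y : hf_ring, hmul x y = hone /\ hmul y x = hone
}.

Declare Scope hyper_scope.
Delimit Scope hyper_scope with hyper.
Notation "A [+] B" := (hypersum hadd A B)
  (at level 50, left associativity) : hyper_scope.
Notation "x [*] y" := (hmul x y)
  (at level 40, left associativity) : hyper_scope.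

Local Open Scope hyper_scope.

Definition doubly_distributive (F : skewHyperring) : Prop :=
  forall a b c d : F,
    [set x [*] y | x in hadd a b & y in hadd c d] =
    [set a [*] c] [+] [set a [*] d] [+] [set b [*] c] [+] [set b [*] d].

Definition stringent (F : skewHyperring) : Prop :=
  forall a b : F, a <> hopp b -> exists c : F, hadd a b = [set c].

(* Main.v *)
Require Import Defs.
From mathcomp Require Import all_boot.
From mathcomp Require Import boolp classical_sets.

(** Let [c] and [d] lie in [a [+] b], where [a <> -b], so that [c] and [d] are
    nonzero. Then
    [0 \in c c^-1 - d d^-1 `<=` (a [+] b) c^-1 [+] (a [+] b) (- d^-1)],
    and by double distributivity the right-hand side is the product set
    [(a [+] b) (c^-1 - d^-1)]. Since there are no zero divisors and
    [0 \notin a [+] b], it follows that [0 \in c^-1 - d^-1], that is, [c = d]. *)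

Set Implicit Arguments.
Unset Strict Implicit.
Unset Printing Implicit Defensive.

Local Open Scope classical_set_scope.
Local Open Scope hyper_scope.

Lemma hypersum11 (S : Type) (op : S -> S -> set S) (x y : S) :
  hypersum op [set x] [set y] = op x y.
Proof. by rewrite /hypersum !bigcup_set1. Qed.

(** Membership in either side is witnessed by a triple from [A], [B], [C], to which the law for
    elements applies. *)
Lemma hypersumA (S : Type) (op : S -> S -> set S) :
  hyperassociative op -> associative (hypersum op).
Proof.
move=> opA A B C; apply/seteqP; split=> z.
- move=> [a Aa [w [b Bb [c Cc bcw]] awz]].
  have : hypersum op [set a] (op b c) z by exists a => //; exists w.
  rewrite opA => -[v abv [_ -> vcz]].
  by exists v; [exists a => //; exists b | exists c].
- move=> [v [a Aa [b Bb abv]] [c Cc vcz]].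
  have : hypersum op (op a b) [set c] z by exists v => //; exists c.
  rewrite -opA => -[_ -> [w bcw awz]].
  by exists a => //; exists w => //; exists b => //; exists c.
Qed.

Lemma hypersumC (S : Type) (op : S -> S -> set S) :
  commutative op -> commutative (hypersum op).
Proof.
move=> opC A B; apply/seteqP; split=> z [a Aa [b Bb abz]];
by exists b => //; exists a => //; rewrite opC.
Qed.

Section Hyperring.
Variable R : skewHyperring.
Implicit Types a b c d x y : R.

Lemma hadd_oppr x : hadd x (hopp x) hzero.
Proof. by have [] := hg_oppr (hadd_hypergroup R) x. Qed.

Lemma hadd_oppl x : hadd (hopp x) x hzero.
Proof. by have [] := hg_oppl (hadd_hypergroup R) x. Qed.

Lemma hadd_eq0 x y : hadd x y hzero -> x = hopp y.
Proof. by move=> xy0; have [_ /(_ _ xy0)] := hg_oppl (hadd_hypergroup R) y. Qed.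

Lemma hoppK : involutive (@hopp R).
Proof. by move=> x; rewrite -(hadd_eq0 (hadd_oppr x)). Qed.

(** [0 = x 0] lies in [x (- y [+] y)], which distributes; inverses are unique. *)
Lemma hmulrN x y : x [*] hopp y = hopp (x [*] y).
Proof.
apply: hadd_eq0; rewrite -hmulDr.
by exists hzero; [exact: hadd_oppl | rewrite hmulx0].
Qed.

(** Double distributivity lists [ac], [ad], [bc], [bd] in this order; grouped by right factor
    instead, they refold into [(a [+] b) c] and [(a [+] b) d] by one-sided distributivity. *)
Lemma hsumACA a b c d :
  [set a] [+] [set b] [+] [set c] [+] [set d] = hadd a c [+] hadd b d.
Proof.
have sumA := hypersumA (hg_addA (hadd_hypergroup R)).
by rewrite -(sumA [set a]) (hypersumC (@haddC R) [set b]) sumA -sumA !hypersum11.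
Qed.

End Hyperring.

(** A left inverse of a nonzero [x] cancels it. *)
Lemma hmul_eq0 (F : skewHyperfield) (x y : F) :
  x [*] y = hzero -> x = hzero \/ y = hzero.
Proof.
move=> xy0; have [|xN0] := pselect (x = hzero); [by left | right].
have [x' [_ x'x]] := hf_inv xN0.
by rewrite -(hmul1x y) -x'x -hmulA xy0 hmulx0.
Qed.

Theorem proposition1p3 (F : skewHyperfield) :
  doubly_distributive F -> stringent F.
Proof.
move=> ddF a b aNb.
have abN0 : ~ hadd a b hzero by move=> /hadd_eq0.
have [c abc] := hyperop_neq0 hadd a b.
exists c; apply/seteqP; split=> [d abd /=|_ -> //].
have [c' [cc' _]] : exists c', c [*] c' = hone /\ c' [*] c = hone.
  by apply: hf_inv => c0; apply: abN0; rewrite -c0.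
have [d' [dd' d'd]] : exists d', d [*] d' = hone /\ d' [*] d = hone.
  by apply: hf_inv => d0; apply: abN0; rewrite -d0.
have : [set x [*] y | x in hadd a b & y in hadd c' (hopp d')] hzero.
  rewrite ddF hsumACA -!hmulDl.
  (* Zero arises as [1 - 1], with [1 = c c'] in the first summand and [- 1 = d (- d')] in the
     second. *)
  exists hone; first by exists c.
  exists (hopp hone); last exact: hadd_oppr.
  by exists d => //; rewrite hmulrN dd'.
move=> [x abx [y c'd'y /hmul_eq0[x0|y0]]].
  by case: abN0; rewrite -x0.
move: c'd'y; rewrite y0 => /hadd_eq0; rewrite hoppK => c'd'.
(* Since [c' = d'], one gets [d = (c c') d = c (d' d) = c]. *)
by rewrite -(hmul1x d) -cc' c'd' -hmulA d'd hmulx1.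
Qed.
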